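(* Let $N \geq 2$ be an integer. There is no positive function $u \in C^{2N}(\mathbf{R}^{2N-1})$ satisfying $$(-\Delta)^N u = u^{-(4N-1)} \quad \text{in } \mathbf{R}^{2N-1}$$ together with all of the following conditions: (1) $\int_{\mathbf{R}^{2N-1}} u^{-(4N-2)}\, dx < \infty$; (2) $u \geq 1$ on $\mathbf{R}^{2N-1}$ and $u(0)=1$; (3) $(-\Delta)^i u \in L^2(\mathbf{R}^{2N-1})$ for all $i=1,2,\dots,N-1$.
   Context: Here $\Delta$ is the Euclidean Laplacian and $(-\Delta)^i$ denotes the $i$-th iterate of $-\Delta$. *)

(* Defs.v *)
From HB Require Import structures.
From mathcomp Require Import all_boot all_order all_algebra.
From mathcomp Require Import all_classical all_reals all_analysis.

Set Implicit Arguments.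
Unset Strict Implicit.
Unset Printing Implicit Defensive.

Import Order.TTheory GRing.Theory Num.Theory.
Import numFieldNormedType.Exports.

Local Open Scope classical_set_scope.
Local Open Scope ring_scope.

Definition measure_rV_display : measure_display -> measure_display.
Proof. exact. Qed.

(* The sigma-algebra on row vectors is the one generated by the coordinate
   functions, as the library does for tuples; for T = R it is the Borel
   sigma-algebra of R^n. *)
Section measurable_rV.
Context {d} {T : measurableType d} (n : nat).

Let coord (i : 'I_n) (x : 'rV[T]_n) : T := x ord0 i.

Let rV_set0 : g_sigma_preimage coord set0.
Proof. exact: sigma_algebra0. Qed.

Let rV_setC A : g_sigma_preimage coord A -> g_sigma_preimage coord (~` A).
Proof. exact: sigma_algebraC. Qed.

Let rV_bigcup (F : _^nat) : (forall i, g_sigma_preimage coord (F i)) ->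
  g_sigma_preimage coord (\bigcup_i (F i)).
Proof. exact: sigma_algebra_bigcup. Qed.

HB.instance Definition _ := @isMeasurable.Build (measure_rV_display d)
  'rV[T]_n (g_sigma_preimage coord) rV_set0 rV_setC rV_bigcup.

End measurable_rV.

Lemma measurable_coord d (T : measurableType d) n (i : 'I_n) :
  measurable_fun [set: 'rV[T]_n] (fun x : 'rV[T]_n => x ord0 i).
Proof.
move=> _ Y mY; rewrite setTI; apply: sub_sigma_algebra => /=.
rewrite -bigcup_seq/=; exists i => /=; first by rewrite mem_index_enum.
by exists Y => //; rewrite setTI.
Qed.

Lemma measurable_fun_rVP d1 d2 (T1 : measurableType d1)
    (T2 : measurableType d2) n (f : T1 -> 'rV[T2]_n) :
  measurable_fun [set: T1] f <->
  forall i, measurable_fun [set: T1] (fun x => f x ord0 i).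
Proof.
split=> [mf i|mf].
  exact: (measurableT_comp (measurable_coord i) mf).
have prefS : g_sigma_preimage (fun i x => f x ord0 i) `<=` measurable.
  apply: smallest_sub; first exact: sigma_algebra_measurable.
  case: n => [|n] in f mf *; first by rewrite big_ord0.
  rewrite -bigcup_mkord_ord; apply: bigcup_sub => i Ii.
  by move=> A [B mB <-]; exact: mf.
move=> _ A mA; apply: prefS.
rewrite (g_sigma_preimage_comp (fun i (x : 'rV[T2]_n) => x ord0 i) f).
by exists A.
Qed.

Section lebesgue_measure_rV.
Variable R : realType.

Definition rV_cons n (p : R * 'rV[R]_n) : 'rV[R]_n.+1 :=
  \row_i (if unlift ord0 i is Some j then p.2 ord0 j else p.1).

Definition rV_uncons n (x : 'rV[R]_n.+1) : R * 'rV[R]_n :=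
  (x ord0 ord0, \row_i x ord0 (lift ord0 i)).

Lemma rV_cons0 n (p : R * 'rV[R]_n) : rV_cons p ord0 ord0 = p.1.
Proof. by rewrite mxE unlift_none. Qed.

Lemma rV_consS n (p : R * 'rV[R]_n) i :
  rV_cons p ord0 (lift ord0 i) = p.2 ord0 i.
Proof. by rewrite mxE liftK. Qed.

Lemma rV_consK n : cancel (@rV_cons n) (@rV_uncons n).
Proof.
case=> a x; rewrite /rV_uncons rV_cons0; congr pair.
by apply/rowP => i; rewrite mxE rV_consS.
Qed.

Lemma measurable_rV_cons n : measurable_fun setT (@rV_cons n).
Proof.
apply/measurable_fun_rVP => i; case: (unliftP ord0 i) => [j ->|->].
  under eq_fun do rewrite rV_consS.
  exact: (measurableT_comp (measurable_coord j) measurable_snd).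
by under eq_fun do rewrite rV_cons0; exact: measurable_fst.
Qed.

Lemma measurable_rV_uncons n : measurable_fun setT (@rV_uncons n).
Proof.
apply/measurable_fun_pairP; split; first exact: (measurable_coord ord0).
apply/measurable_fun_rVP => i.
rewrite (_ : (fun x => _) = (fun x : 'rV[R]_n.+1 => x ord0 (lift ord0 i))).
  exact: measurable_coord.
by apply/funext => x; rewrite /= mxE.
Qed.

Section step.
Variables (n : nat) (mu : {sigma_finite_measure set 'rV[R]_n -> \bar R}).

Definition lebesgue_rV_step : set 'rV[R]_n.+1 -> \bar R :=
  pushforward (@lebesgue_measure R \x mu)%E (@rV_cons n).

Let lebesgue_rV_step_sigma_finite : sigma_finite setT lebesgue_rV_step.
Proof.
have /sigma_finiteP[F [TF ndF Foo]] := sigma_finiteT (@lebesgue_measure R).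
have /sigma_finiteP[G [TG ndG Goo]] := sigma_finiteT mu.
exists (fun k => @rV_uncons n @^-1` (F k `*` G k)).
  rewrite predeqE => x; split=> // _.
  have [i _ Fi] : (\bigcup_i F i) (rV_uncons x).1 by rewrite -TF.
  have [j _ Gj] : (\bigcup_j G j) (rV_uncons x).2 by rewrite -TG.
  exists (maxn i j) => //; split.
    by move: Fi; exact/subsetPset/ndF/leq_maxl.
  by move: Gj; exact/subsetPset/ndG/leq_maxr.
move=> k; have [mF Fk] := Foo k; have [mG Gk] := Goo k; split.
  rewrite -[X in measurable X]setTI.
  by apply: measurable_rV_uncons => //; exact: measurableX.
rewrite /lebesgue_rV_step /pushforward -comp_preimage.
rewrite (_ : _ \o _ = id); last exact/funext/rV_consK.
by rewrite preimage_id product_measure1E// lte_mul_pinfty// ge0_fin_numE.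
Qed.

Let lebesgue_rV_step0 : lebesgue_rV_step set0 = 0%E.
Proof. by rewrite /lebesgue_rV_step /pushforward preimage_set0 measure0. Qed.

Let lebesgue_rV_step_ge0 A : (0 <= lebesgue_rV_step A)%E.
Proof. by rewrite /lebesgue_rV_step /pushforward measure_ge0. Qed.

Let lebesgue_rV_step_sigma_additive : semi_sigma_additive lebesgue_rV_step.
Proof.
by apply: measure_semi_sigma_additive; exact: measurable_rV_cons.
Qed.

HB.instance Definition _ := isMeasure.Build _ _ _ lebesgue_rV_step
  lebesgue_rV_step0 lebesgue_rV_step_ge0 lebesgue_rV_step_sigma_additive.

HB.instance Definition _ := Measure_isSigmaFinite.Build _ _ _ lebesgue_rV_step
  lebesgue_rV_step_sigma_finite.

End step.

Fixpoint lebesgue_rV n : {sigma_finite_measure set 'rV[R]_n -> \bar R} :=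
  if n is n'.+1 then lebesgue_rV_step (lebesgue_rV n')
  else \d_(0 : 'rV[R]_0).

(* Together with sigma-finiteness, this determines lebesgue_rV n uniquely as
   the n-dimensional Lebesgue measure (on Borel sets). *)
Lemma lebesgue_rV_box n (A : 'I_n -> set (measurableTypeR R)) :
  (forall i, measurable (A i)) ->
  lebesgue_rV n [set x : 'rV[R]_n | forall i, A i (x ord0 i)] =
    (\prod_(i < n) lebesgue_measure (A i))%E.
Proof.
elim: n A => [|n IHn] A mA.
  by rewrite big_ord0 /= diracE mem_set//= => -[].
have mB : measurable [set x : 'rV[R]_n | forall i, A (lift ord0 i) (x ord0 i)].
  rewrite (_ : mkset _ = \bigcap_(i in [set: 'I_n])
      ((fun x : 'rV[R]_n => x ord0 i) @^-1` A (lift ord0 i))); last first.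
    by apply/seteqP; split=> x /= Ax i; [move=> _|]; exact: Ax.
  apply: fin_bigcap_measurable => [|i _]; first exact: finite_finset.
  rewrite -[X in measurable X]setTI.
  by apply: (@measurable_coord _ R n i) => //; exact: (mA (lift ord0 i)).
rewrite big_ord_recl -IHn// -product_measure1E//=.
rewrite /lebesgue_rV_step /pushforward; congr (_ _).
apply/seteqP; split=> -[t x] /=.
  move=> Ax; split=> /= [|i]; first by have := Ax ord0; rewrite rV_cons0.
  by have := Ax (lift ord0 i); rewrite rV_consS.
move=> [/= At Ax] i; case: (unliftP ord0 i) => [j ->|->].
  by rewrite rV_consS; exact: Ax.
by rewrite rV_cons0.
Qed.

End lebesgue_measure_rV.

Section calculus_rV.
Variables (R : realType) (n : nat).
Implicit Types f : 'rV[R]_n -> R.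

Definition partial (i : 'I_n) f : 'rV[R]_n -> R := 'D_(delta_mx 0 i) f.

(* f is of class C^k: all partial derivatives of f of order at most k exist
   everywhere and are continuous. The existence clause is needed because
   'D_v is a total function with a junk value where f is not derivable. *)
Fixpoint Ck (k : nat) f : Prop :=
  continuous f /\
  if k is k'.+1 then
    forall i, (forall x, derivable f x (delta_mx 0 i)) /\ Ck k' (partial i f)
  else True.

Definition laplacian f : 'rV[R]_n -> R :=
  fun x => \sum_(i < n) partial i (partial i f) x.

Definition iter_opp_laplacian (k : nat) f : 'rV[R]_n -> R :=
  iter k (fun g x => - laplacian g x) f.

End calculus_rV.

(* Main.v *)
Require Import Defs.
From mathcomp Require Import all_boot all_order all_algebra.
From mathcomp Require Import ring lra zify.
From mathcomp Require Import all_classical all_reals all_analysis.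
Import Order.TTheory GRing.Theory Num.Theory.
Import numFieldNormedType.Exports.
Local Open Scope classical_set_scope.
Local Open Scope ring_scope.

(* Write v = -Delta u, which lies in L^2, and f = (-Delta)^(N-1) v, which is
   positive. Testing f against phi(r x), where phi is a nonnegative compactly
   supported bump, and moving all the Laplacians onto phi gives
     int f(x) phi(r x) dx = r^(2(N-1)) int v(x) ((-Delta)^(N-1) phi)(r x) dx.
   By Young's inequality v * (...) <= a/2 v^2 + (...)^2 / (2a) the right-hand
   side is at most a/2 |v|_2^2 + O(r^(4(N-1) - (2N-1))) / (2a), and
   4(N-1) - (2N-1) = 2N-3 > 0, so it becomes arbitrarily small as first a and
   then r tends to 0. The left-hand side stays bounded away from 0. *)

(** * Topology, Borel sets and integrability on row vectors *)

Section topology_rV.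
Context {R : realType}.

Lemma continuous_rV (T : topologicalType) n (f : T -> 'rV[R]_n) :
  (forall i, continuous (fun t => f t ord0 i)) -> continuous f.
Proof.
move=> cf t A [P HP sPA].
have : \forall s \near t, forall i, P ord0 i (f s ord0 i).
  by apply: filter_forall => i; apply: (cf i t); exact: HP.
by apply: filterS => s Hs; apply: sPA => i j; rewrite ord1.
Qed.

Lemma continuous_coord n (i : 'I_n) :
  continuous (fun x : 'rV[R]_n => x ord0 i).
Proof. exact: coord_continuous. Qed.

Lemma nbhs_rV_box {n} {x : 'rV[R]_n} {A : set 'rV[R]_n} : nbhs x A ->
  exists2 e, 0 < e & forall y : 'rV[R]_n, (forall i, `|y ord0 i - x ord0 i| < e) -> A y.
Proof.
move=> /nbhs_ballP[e e0 sA]; exists e => // y yx; apply: sA.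
by split=> // i j; rewrite ord1 /ball/= distrC.
Qed.

Lemma measurable_box n (a b : 'I_n -> R) :
  measurable [set x : 'rV[R]_n | forall i, a i <= x ord0 i <= b i].
Proof.
rewrite (_ : mkset _ = \bigcap_(i in [set: 'I_n])
    ((fun x : 'rV[R]_n => x ord0 i) @^-1` `[a i, b i])); last first.
  apply/seteqP; split=> x /= Ax i; first by move=> _; rewrite /= in_itv/=.
  by have := Ax i I; rewrite /= in_itv.
apply: fin_bigcap_measurable => [|i _]; first exact: finite_finset.
rewrite -[X in measurable X]setTI.
by apply: (@measurable_coord _ R n i) => //; exact: measurable_itv.
Qed.

(** The sigma-algebra is generated by coordinates, not by open sets, so the two have to be linked:
    an open set is the union of the boxes with rational centre and rational radius that it contains,
    and there are countably many of them. *)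
Lemma open_rV_measurable n (U : set 'rV[R]_n) : open U -> measurable U.
Proof.
move=> oU.
pose B (q : 'rV[rat]_n * rat) := [set x : 'rV[R]_n | forall i,
  ratr (q.1 ord0 i) - ratr q.2 <= x ord0 i <= ratr (q.1 ord0 i) + ratr q.2].
have -> : U = \bigcup_(q in [set q | B q `<=` U]) B q.
  apply/seteqP; split=> [x Ux|x [q qU]]; last exact: qU.
  have /nbhs_rV_box[e e0 eU] : nbhs x U by exact: open_nbhs_nbhs.
  (* With [r] below [e / 2] and a rational centre within [r] of [x], every point of the box is
     within [r + r < e] of [x], and [x] itself lies in the box. *)
  have [r] := rat_in_itvoo (divr_gt0 e0 (ltr0Sn R 1)).
  rewrite in_itv/= => /andP[r0 re].
  have rr0 : 0 < ratr r :> R by rewrite r0.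
  have /choice[q qP] (i : 'I_n) : exists p : rat,
      `|ratr p - x ord0 i| < ratr r.
    have [p] : exists p : rat, ratr p \in `](x ord0 i - ratr r), (x ord0 i + ratr r)[.
      by apply: rat_in_itvoo; rewrite ltrD2l gt0_cp.
    by rewrite in_itv/= => pP; exists p; rewrite ltr_distl.
  exists (\row_i q i, r) => [y By|i] /=.
    apply: eU => i; have := By i; rewrite /= mxE -ler_distl => yq.
    rewrite (le_lt_trans (ler_distD (ratr (q i)) _ _))//.
    by rewrite (splitr e) ltrD ?(le_lt_trans yq)// (lt_trans (qP i)).
  by rewrite mxE -ler_distl distrC ltW.
rewrite bigcup_mkcond; apply: countable_bigcupT_measurable => // -[q r].
by case: ifPn => // _; exact: measurable_box.
Qed.

Lemma continuous_measurable_rV n (f : 'rV[R]_n -> R) :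
  continuous f -> measurable_fun setT f.
Proof.
move=> /continuousP cf; apply: (measurability _ (measurable_realfun.RGenOpens.measurableE R)).
move=> _ [_ [a [b ->] <-]]; rewrite setTI; apply: open_rV_measurable.
exact/cf/interval_open.
Qed.

(** A closed ball of the sup norm: compact as a product of segments, with a volume given directly by
    [lebesgue_rV_box]. *)
Definition cube n (M : R) : set 'rV[R]_n := [set x | forall i, `|x ord0 i| <= M].

Definition supported n (M : R) (f : 'rV[R]_n -> R) := forall x, ~ cube n M x -> f x = 0.

Lemma compact_cube n M : compact (cube n M).
Proof.
rewrite (_ : cube n M = [set v | forall i, `[- M, M]%classic (v ord0 i)]).
  by apply: (@rV_compact R n (fun=> `[- M, M]%classic)) => _; exact: segment_compact.
by apply/seteqP; split=> x /= xM i; have := xM i; rewrite in_itv/= ler_norml.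
Qed.

Lemma measurable_cube n M : measurable (cube n M).
Proof.
rewrite (_ : cube n M = [set x | forall i, - M <= x ord0 i <= M]).
  exact: (measurable_box n (fun=> - M) (fun=> M)).
by apply/seteqP; split=> x /= xM i; have := xM i; rewrite ler_norml.
Qed.

Lemma lebesgue_cube n M : 0 <= M ->
  lebesgue_rV R n (cube n M) = ((2 * M) ^+ n)%:E.
Proof.
move=> M0; rewrite (_ : cube n M = [set x | forall i, `[- M, M]%classic (x ord0 i)]).
  rewrite (@lebesgue_rV_box R n (fun=> `[- M, M]%classic)); last first.
    by move=> i; exact: measurable_itv.
  rewrite (eq_bigr (fun=> (2 * M)%:E)) => [|i _].
    by rewrite prodEFin prodr_const card_ord.
  rewrite lebesgue_measure_itv/= lte_fin -EFinD.
  by case: ltrP => MM; congr EFin; lra.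
by apply/seteqP; split=> x /= xM i; have := xM i; rewrite in_itv/= ler_norml.
Qed.

Lemma continuous_supported_bounded {n M} {f : 'rV[R]_n -> R} :
  continuous f -> supported n M f -> exists2 C, 0 <= C & forall x, `|f x| <= C.
Proof.
move=> cf sf.
have /compact_bounded[C [_ CP]] : compact (f @` cube n M).
  apply: continuous_compact; last exact: compact_cube.
  exact: continuous_subspaceT.
exists (`|C| + 1) => [|x]; first by rewrite addr_ge0.
have [xM|xM] := pselect (cube n M x); last by rewrite sf// normr0 addr_ge0.
by apply: CP; [rewrite ltr_pwDr// ler_norm|exists x].
Qed.

Lemma continuous_supported_integrable {n M} {f : 'rV[R]_n -> R} :
  continuous f -> supported n M f ->
  (lebesgue_rV R n).-integrable setT (EFin \o f).
Proof.
move=> cf sf.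
have [C C0 fC] := continuous_supported_bounded cf sf.
(* [M] may be negative while the volume formula needs a nonnegative half-side; [cube n M] is
   contained in the cube of half-side [|M|]. *)
have fin : (lebesgue_rV R n (cube n `|M|) < +oo)%E by rewrite lebesgue_cube ?ltry.
have ic : (lebesgue_rV R n).-integrable (cube n `|M|) (EFin \o f).
  apply: measurable_bounded_integrable; first exact: measurable_cube.
  - exact: fin.
  - by apply: measurable_funTS; exact: continuous_measurable_rV.
  - exists C; split; first by rewrite num_real.
    by move=> y Cy x _ /=; rewrite (le_trans (fC x))// ltW.
rewrite (_ : EFin \o f = (EFin \o f) \_ (cube n `|M|)).
  exact: (iffLR (integrable_mkcond _ (measurable_cube n `|M|)) ic).
apply/funext => x; rewrite patchE; case: ifPn => // /negP xM.
rewrite /= sf// => Mx; apply: xM; rewrite inE => i.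
exact/(le_trans (Mx i))/ler_norm.
Qed.

End topology_rV.

(** * Partial derivatives of compactly supported functions have integral zero *)

Section divergence.
Context {R : realType}.

Section quotient.
Context {V V' : normedModType R} {f : V -> R} {g : V' -> R} {a v : V} {b w : V'}.
Hypothesis fg : forall h : R, f (h *: v + a) = g (h *: w + b).

Let quotient_eq :
  (fun h : R => h^-1 *: ((f \o shift a) (h *: v) - f a)) =
  (fun h : R => h^-1 *: ((g \o shift b) (h *: w) - g b)).
Proof.
apply/funext => h /=; rewrite fg; congr (_ *: (_ - _)).
by have := fg 0; rewrite !scale0r !add0r.
Qed.

(** A directional derivative depends only on the restriction to a line. This trades a partial
    derivative in [n.+1] variables for one in [n] variables, or for an ordinary derivative of a real
    function. *)
Lemma derivable_eq_line : derivable f a v -> derivable g b w.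
Proof. by rewrite /derivable quotient_eq. Qed.

Lemma derive_eq_line : 'D_v f a = 'D_w g b.
Proof. by rewrite /derive quotient_eq. Qed.

End quotient.

Lemma continuous_rV_cons2 n (t : R) : continuous (fun x : 'rV[R]_n => rV_cons (t, x)).
Proof.
apply: continuous_rV => i; case: (unliftP ord0 i) => [j ->|->].
  under eq_fun do rewrite rV_consS.
  exact: continuous_coord.
by under eq_fun do rewrite rV_cons0; exact: cst_continuous.
Qed.

Lemma continuous_rV_cons1 n (x : 'rV[R]_n) : continuous (fun t : R => rV_cons (t, x)).
Proof.
apply: continuous_rV => i; case: (unliftP ord0 i) => [j ->|->].
  by under eq_fun do rewrite rV_consS; exact: cst_continuous.
by under eq_fun do rewrite rV_cons0; move=> s; exact: cvg_id.
Qed.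

Lemma rV_cons_line1 n (x : 'rV[R]_n) t h :
  rV_cons (h *: 1 + t, x) = h *: delta_mx 0 ord0 + rV_cons (t, x).
Proof.
apply/rowP => i; rewrite !mxE eqxx/=; case: (unliftP ord0 i) => [j ->|->].
  by rewrite /= mulr0 add0r.
by rewrite eqxx/=.
Qed.

Lemma rV_cons_line2 n (x : 'rV[R]_n) t (j : 'I_n) h :
  rV_cons (t, h *: delta_mx 0 j + x) = h *: delta_mx 0 (lift ord0 j) + rV_cons (t, x).
Proof.
apply/rowP => i; rewrite !mxE eqxx/=; case: (unliftP ord0 i) => [k ->|->].
  by rewrite !mxE eqxx/= (inj_eq lift_inj).
by rewrite /= mulr0 add0r.
Qed.

(** Fundamental theorem of calculus on a segment at whose endpoints [f] vanishes. *)
Lemma integral_derive1_supported (M : R) (f : R -> R) :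
  (forall t, derivable f t 1) -> continuous f^`()%classic ->
  (forall t, M < `|t| -> f t = 0) ->
  (\int[lebesgue_measure]_t (f^`()%classic t)%:E = 0)%E.
Proof.
(* The added 1 makes [N] positive and larger than [M] whatever the sign of [M], so that [f] vanishes
   at both endpoints and the segment is nondegenerate. *)
move=> df cf' sf; set N : R := `|M| + 1.
have MN : M < N by rewrite ltr_pwDr// ler_norm.
have N0 : 0 < N by rewrite ltr_pwDr.
have cf : continuous f.
  by move=> t; apply/differentiable_continuous/derivable1_diffP.
have f0 t : N <= `|t| -> f t = 0 by move=> Nt; apply: sf; exact: lt_le_trans Nt.
have f'0 t : N < `|t| -> f^`()%classic t = 0.
  move=> Nt; rewrite derive1E (@near_eq_derive _ _ _ _ (cst 0)) ?derive_cst//.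
  near=> s; apply: f0; near: s.
  have := @norm_continuous _ _ t; move/(_ [set x | N <= x]); apply.
  by near=> s; apply: ltW; near: s; exact: lt_nbhsr.
have -> : (\int[lebesgue_measure]_t (f^`()%classic t)%:E =
           \int[lebesgue_measure]_(t in `[(- N)%R, N]) (f^`()%classic t)%:E)%E.
  rewrite [RHS]integral_mkcond; apply: eq_integral => t _; rewrite patchE.
  case: ifPn => // /negP; rewrite inE/= in_itv/= -ler_norml => /negP.
  by rewrite -ltNge => /f'0 ->.
rewrite (@continuous_FTC2 _ _ f).
- by rewrite !f0 ?normrN ?ger0_norm ?subee// ltW.
- by rewrite -subr_gt0; lra.
- exact: continuous_subspaceT.
- by split=> [t _//||]; [exact/cvg_at_right_filter/cf|exact/cvg_at_left_filter/cf].
- by move=> t _.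
Unshelve. all: by end_near. Qed.

(** The complement of a cube is open, so [f] is zero near each of its points and the derivative
    there is that of a constant. *)
Lemma supported_partial {n M} {f : 'rV[R]_n -> R} i :
  supported n M f -> supported n M (partial i f).
Proof.
move=> sf x xM; rewrite /partial (@near_eq_derive _ _ _ _ (cst 0)) ?derive_cst//.
have oC : open (~` cube n M).
  apply: closed_openC; apply: compact_closed; first exact: (@norm_hausdorff R).
  exact: compact_cube.
have : nbhs x (~` cube n M) by apply: open_nbhs_nbhs.
by apply: filterS => y; exact: sf.
Qed.

(** The measure in dimension [n.+1] is a pushforward along [rV_cons]; going back to the product
    measure makes Fubini's theorem available. *)
Lemma integrable_rV_cons {n} {f : 'rV[R]_n.+1 -> \bar R} :
  (lebesgue_rV R n.+1).-integrable setT f ->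
  (@lebesgue_measure R \x lebesgue_rV R n)%E.-integrable setT (f \o @rV_cons R n).
Proof.
move=> fi; have /integrableP[mf foo] := fi; apply/integrableP; split.
  exact: (measurable_comp measurableT (@subsetT _ _) mf (@measurable_rV_cons R n)).
move: foo; rewrite /= /lebesgue_rV_step ge0_integral_pushforward//.
  exact: measurable_rV_cons.
exact: measurable_int (integrable_abse fi).
Qed.

Lemma integral_rV_cons {n} {f : 'rV[R]_n.+1 -> \bar R} :
  (lebesgue_rV R n.+1).-integrable setT f ->
  (\int[lebesgue_rV R n.+1]_x f x =
   \int[@lebesgue_measure R \x lebesgue_rV R n]_p f (rV_cons p))%E.
Proof.
move=> fi; rewrite /= /lebesgue_rV_step integral_pushforward//.
- exact: measurable_rV_cons.
- exact: measurable_int fi.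
- exact: integrable_rV_cons.
Qed.

(** Induction on the dimension, splitting off the first coordinate by Fubini and integrating first
    over the variables that include the [i]-th one. *)
Lemma integral_partial_supported {n M} (i : 'I_n) {f : 'rV[R]_n -> R} :
  (forall x, derivable f x (delta_mx 0 i)) -> continuous (partial i f) ->
  supported n M f -> (\int[lebesgue_rV R n]_x (partial i f x)%:E = 0)%E.
Proof.
elim: n => [|n IHn] in i f *; first by case: i.
move=> df cf sf.
have fi := continuous_supported_integrable cf (supported_partial i sf).
have fi' := integrable_rV_cons fi.
rewrite integral_rV_cons//.
(* If [i] is a later coordinate, the inner integral runs over the last [n] variables and vanishes by
   the induction hypothesis. *)
case: (unliftP ord0 i) => [j|] ij; rewrite {}ij {i} in df cf fi fi' *.
  rewrite -(integral12_prod_meas1 fi') integral0_eq// => t _.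
  have fE x h := congr1 f (rV_cons_line2 n x t j h).
  rewrite /fubini_F -[RHS](IHn j (fun x => f (rV_cons (t, x)))).
  - by apply: eq_integral => x _; congr EFin; rewrite /= /partial (derive_eq_line (fE x)).
  - move=> x; apply: derivable_eq_line (df (rV_cons (t, x))) => h.
    exact/esym/fE.
  - rewrite (_ : partial j _ = fun x => partial (lift ord0 j) f (rV_cons (t, x))).
      by move=> x; apply: continuous_comp; [exact: continuous_rV_cons2|exact: cf].
    by apply/funext => x; rewrite /partial (derive_eq_line (fE x)).
  - move=> x xM; apply: sf => xM'; apply: xM => k.
    by have := xM' (lift ord0 k); rewrite rV_consS.
(* If [i] is the first coordinate, the order is exchanged: the inner integral is one-dimensional and
   vanishes by the fundamental theorem of calculus. *)
rewrite -(integral21_prod_meas1 fi') integral0_eq// => x _.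
have fE t h := congr1 f (rV_cons_line1 n x t h).
rewrite /fubini_G -[RHS](integral_derive1_supported M (fun t => f (rV_cons (t, x)))).
- apply: eq_integral => t _; congr EFin.
  by rewrite derive1E /= /partial (derive_eq_line (fE t)).
- move=> t; apply: derivable_eq_line (df (rV_cons (t, x))) => h.
  exact/esym/fE.
- rewrite (_ : _^`()%classic = fun t => partial ord0 f (rV_cons (t, x))).
    by move=> t; apply: continuous_comp; [exact: continuous_rV_cons1|exact: cf].
  by apply/funext => t; rewrite derive1E /partial (derive_eq_line (fE t)).
- move=> t tM; apply: sf => /(_ ord0).
  by rewrite rV_cons0/= leNgt tM.
Qed.

End divergence.

(** * Functions of class C^k, and Green's identity for iterated Laplacians *)

Section Ck_theory.
Context {R : realType} {n : nat}.
Implicit Types f g : 'rV[R]_n -> R.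

Lemma Ck_continuous {k f} : Ck k f -> continuous f.
Proof. by case: k => [|k] []. Qed.

Lemma Ck_derivable {k f} i : Ck k.+1 f -> forall x, derivable f x (delta_mx 0 i).
Proof. by move=> [_ /(_ i)[]]. Qed.

Lemma Ck_partial {k f} i : Ck k.+1 f -> Ck k (partial i f).
Proof. by move=> [_ /(_ i)[]]. Qed.

Lemma CkW {k f} : Ck k.+1 f -> Ck k f.
Proof.
elim: k f => [|k IHk] f; first by case.
move=> [cf fk]; split=> // i; have [df ckf] := fk i.
by split=> //; exact: IHk.
Qed.

Lemma Ck_leq {k l f} : (k <= l)%N -> Ck l f -> Ck k f.
Proof. by move=> /subnK <-; elim: (l - k)%N => [//|m IHm] /CkW/IHm. Qed.

Lemma partialD {f g} i : (forall x, derivable f x (delta_mx 0 i)) ->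
  (forall x, derivable g x (delta_mx 0 i)) ->
  partial i (f \+ g) = partial i f \+ partial i g.
Proof. by move=> df dg; apply/funext => x; exact: deriveD. Qed.

Lemma partialN {f} i : (forall x, derivable f x (delta_mx 0 i)) ->
  partial i (fun x => - f x) = (fun x => - partial i f x).
Proof. by move=> df; apply/funext => x; exact: deriveN. Qed.

Lemma partialB {f g} i : (forall x, derivable f x (delta_mx 0 i)) ->
  (forall x, derivable g x (delta_mx 0 i)) ->
  partial i (f \- g) = partial i f \- partial i g.
Proof. by move=> df dg; apply/funext => x; exact: deriveB. Qed.

Lemma partialM {f g} i : (forall x, derivable f x (delta_mx 0 i)) ->
  (forall x, derivable g x (delta_mx 0 i)) ->
  partial i (f \* g) = (f \* partial i g) \+ (partial i f \* g).
Proof.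
move=> df dg; apply/funext => x /=.
by rewrite [RHS]/= [partial i f x * _]mulrC; exact: deriveM.
Qed.

Lemma CkD {k f g} : Ck k f -> Ck k g -> Ck k (f \+ g).
Proof.
elim: k => [|k IHk] in f g * => -[cf fk] [cg gk].
  by split=> // x; exact: continuousD (cf x) (cg x).
split=> [x|i]; first exact: continuousD (cf x) (cg x).
have [df ckf] := fk i; have [dg ckg] := gk i; split.
  by move=> x; exact: derivableD.
by rewrite partialD//; exact: IHk.
Qed.

Lemma CkN {k f} : Ck k f -> Ck k (fun x => - f x).
Proof.
elim: k => [|k IHk] in f * => -[cf fk].
  by split=> // x; exact: continuousN (cf x).
split=> [x|i]; first exact: continuousN (cf x).
have [df ckf] := fk i; split; first by move=> x; exact: derivableN.
by rewrite partialN//; exact: IHk.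
Qed.

Lemma Ck0 {k} : Ck k (fun _ : 'rV[R]_n => 0).
Proof.
elim: k => [|k IHk]; split=> //; try exact: cst_continuous.
move=> i; split; first by move=> x; exact: derivable_cst.
rewrite (_ : partial i _ = fun=> 0)//.
by apply/funext => x; exact: derive_cst.
Qed.

Lemma Ck_sum {k} (I : Type) (r : seq I) (F : I -> 'rV[R]_n -> R) :
  (forall i, Ck k (F i)) -> Ck k (fun x => \sum_(i <- r) F i x).
Proof.
move=> CF; elim: r => [|i r IHr].
  by under eq_fun do rewrite big_nil; exact: Ck0.
by under eq_fun do rewrite big_cons; exact: CkD.
Qed.

Lemma Ck_laplacian {k f} : Ck k.+2 f -> Ck k (laplacian f).
Proof.
by move=> Cf; apply: Ck_sum => i; do 2 apply: Ck_partial.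
Qed.

Lemma Ck_iter_opp_laplacian {k m f} : Ck (m.*2 + k) f ->
  Ck k (iter_opp_laplacian m f).
Proof.
elim: m k => [//|m IHm] k Cf /=.
by apply/CkN/Ck_laplacian/IHm; rewrite !addnS -addSn -addSn -doubleS.
Qed.

Lemma supported_laplacian {M f} : supported n M f -> supported n M (laplacian f).
Proof.
move=> sf x xM; rewrite /laplacian big1// => i _.
exact: supported_partial (supported_partial i sf) x xM.
Qed.

Lemma supported_iter_opp_laplacian {M m f} :
  supported n M f -> supported n M (iter_opp_laplacian m f).
Proof.
move=> sf; elim: m => [//|m IHm] x xM /=.
by rewrite (supported_laplacian IHm)// oppr0.
Qed.

Lemma Ck_supported_integrable {k M f g} : Ck k f -> Ck k g -> supported n M g ->
  (lebesgue_rV R n).-integrable setT (EFin \o (f \* g)).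
Proof.
move=> Cf Cg sg; apply: (@continuous_supported_integrable _ _ M).
  by move=> x; exact: continuousM (Ck_continuous Cf x) (Ck_continuous Cg x).
by move=> x xM /=; rewrite sg// mulr0.
Qed.

(** The difference of the two integrands is the divergence of f grad g - g grad f, a field supported
    where [g] is, so each of its terms integrates to zero. *)
Lemma integral_greens_identity {M f g} : Ck 2 f -> Ck 2 g -> supported n M g ->
  \int[lebesgue_rV R n]_x (- laplacian f x * g x) =
  \int[lebesgue_rV R n]_x (f x * - laplacian g x).
Proof.
move=> Cf Cg sg.
have C0f : Ck 0 f by exact: Ck_leq Cf.
have C0g : Ck 0 g by exact: Ck_leq Cg.
have i1 := Ck_supported_integrable (CkN (Ck_laplacian Cf)) C0g sg.
have i2 := Ck_supported_integrable C0f (CkN (Ck_laplacian Cg))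
  (@supported_iter_opp_laplacian M 1 g sg).
apply/eqP; rewrite -subr_eq0 -RintegralB//; apply/eqP.
(* The [i]-th component of that field; in its [i]-th derivative the two mixed products of first
   derivatives cancel. *)
pose G i := (f \* partial i g) \- (partial i f \* g).
have df i := Ck_derivable i Cf; have dg i := Ck_derivable i Cg.
have ddf i := Ck_derivable i (Ck_partial i Cf).
have ddg i := Ck_derivable i (Ck_partial i Cg).
have dG1 i x : derivable (f \* partial i g) x (delta_mx 0 i).
  exact: derivableM (df i x) (ddg i x).
have dG2 i x : derivable (partial i f \* g) x (delta_mx 0 i).
  exact: derivableM (ddf i x) (dg i x).
have dG i x : derivable (G i) x (delta_mx 0 i).
  exact: derivableB (dG1 i x) (dG2 i x).
have pG i : partial i (G i) =
    (f \* partial i (partial i g)) \- (partial i (partial i f) \* g).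
  rewrite (partialB i (dG1 i) (dG2 i)) (partialM i (df i) (ddg i)).
  rewrite (partialM i (ddf i) (dg i)); apply/funext => x /=.
  by rewrite opprD addrA addrK.
have cG i : continuous (partial i (G i)).
  have cf := Ck_continuous Cf; have cg := Ck_continuous Cg.
  have cddf := Ck_continuous (Ck_partial i (Ck_partial i Cf)).
  have cddg := Ck_continuous (Ck_partial i (Ck_partial i Cg)).
  rewrite pG => x.
  exact: continuousB (continuousM (cf x) (cddg x)) (continuousM (cddf x) (cg x)).
have sG i : supported n M (G i).
  by move=> x xM; rewrite /G/= sg// (supported_partial i sg)// !mulr0 subrr.
rewrite /Rintegral (eq_integral (fun x => (\sum_(i < n) (partial i (G i) x)%:E)%E)).
  rewrite integral_sum//.
    by rewrite big1// => i _; exact: integral_partial_supported (dG i) (cG i) (sG i).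
  by move=> i; exact: continuous_supported_integrable (cG i) (supported_partial i (sG i)).
move=> x _; rewrite sumEFin; congr EFin.
rewrite mulrN mulNr opprK addrC mulr_suml mulr_sumr -sumrB; apply: eq_bigr => i _.
by rewrite pG.
Qed.

Lemma integral_iter_opp_laplacian {M m f g} :
  Ck m.*2 f -> Ck m.*2 g -> supported n M g ->
  \int[lebesgue_rV R n]_x (iter_opp_laplacian m f x * g x) =
  \int[lebesgue_rV R n]_x (f x * iter_opp_laplacian m g x).
Proof.
elim: m g => [//|m IHm] g Cf Cg sg.
have CLg : Ck m.*2 (iter_opp_laplacian 1 g).
  by apply: Ck_iter_opp_laplacian; rewrite -doubleD.
have sLg : supported n M (iter_opp_laplacian 1 g).
  exact: supported_iter_opp_laplacian.
(* On the right the innermost Laplacian of [g] is split off, so the induction hypothesis applies to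
   [iter_opp_laplacian 1 g]; Green's identity then moves the one Laplacian that remains. *)
rewrite {2}/iter_opp_laplacian iterSr -/(iter_opp_laplacian m (iter_opp_laplacian 1 g)).
rewrite -IHm//; last by apply: Ck_leq Cf; rewrite doubleS !leqW.
apply: (@integral_greens_identity M) => //; last first.
  by apply: Ck_leq Cg; rewrite doubleS.
by apply: Ck_iter_opp_laplacian; rewrite addn2 -doubleS.
Qed.

End Ck_theory.

(** * Test functions of finite smoothness, built from truncated powers *)

Section poly_bump.
Context {R : realType}.

(** The truncated power, of class C^(k-1) for k >= 1. For k = 0 it is the constant 1, which is why
    the vanishing on the negative axis is stated for [k.+1]. *)
Definition relu_exp (k : nat) (x : R) : R := Num.max 0 x ^+ k.

Lemma continuous_relu_exp k : continuous (relu_exp k).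
Proof.
move=> x; apply: (@continuous_comp _ _ _ (fun y : R => Num.max 0 y) (fun y => y ^+ k)).
  by apply: continuous_max; [exact: cvg_cst|exact: cvg_id].
exact: exprn_continuous.
Qed.

Lemma relu_exp_ge0 k x : 0 <= x -> relu_exp k x = x ^+ k.
Proof. by move=> x0; rewrite /relu_exp max_r. Qed.

Lemma relu_exp_le0 k x : x <= 0 -> relu_exp k.+1 x = 0.
Proof. by move=> x0; rewrite /relu_exp max_l// expr0n. Qed.

Lemma relu_expS k x : relu_exp k.+2 x = x * relu_exp k.+1 x.
Proof.
have [x0|/ltW x0] := leP 0 x; first by rewrite !relu_exp_ge0// exprS.
by rewrite !relu_exp_le0// mulr0.
Qed.

Lemma is_derive_exprn k (x : R) :
  is_derive x 1 (fun y : R => y ^+ k) (k%:R * x ^+ k.-1).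
Proof.
by apply: DeriveDef; [exact: exprn_derivable|rewrite exp_derive /GRing.scale/= mulr1].
Qed.

Lemma is_derive_relu_exp k (x : R) :
  is_derive x 1 (relu_exp k.+2) (k.+2%:R * relu_exp k.+1 x).
Proof.
have [x0|x0|->] := ltgtP x 0.
- rewrite relu_exp_le0 ?mulr0 ?ltW//.
  apply: near_eq_is_derive (is_derive_cst (0 : R) x (1 : R)).
  by near=> y; rewrite relu_exp_le0// ltW//; near: y; exact: lt_nbhsl.
- rewrite relu_exp_ge0 ?ltW//.
  apply: near_eq_is_derive (is_derive_exprn k.+2 x).
  by near=> y; rewrite relu_exp_ge0// ltW//; near: y; exact: lt_nbhsr.
(* At the origin the difference quotient is [relu_exp k.+1 h], which tends to 0, the value that the
   formula predicts there. *)
have H : h^-1 *: ((relu_exp k.+2 \o shift 0) (h *: (1 : R)) - relu_exp k.+2 0)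
    @[h --> 0^'] --> relu_exp k.+1 0.
  have c0 : relu_exp k.+1 h @[h --> (0 : R)^'] --> relu_exp k.+1 0.
    by apply: cvg_within_filter; exact: continuous_relu_exp.
  apply: cvg_trans c0; apply: near_eq_cvg; near=> h.
  have h0 : h != 0 by near: h; exact: nbhs_dnbhs_neq.
  rewrite /= addr0 (@relu_exp_le0 _ 0)// subr0 /GRing.scale/= mulr1.
  by rewrite relu_expS mulKf.
have r0 : k.+2%:R * relu_exp k.+1 0 = relu_exp k.+1 0.
  by rewrite relu_exp_le0// mulr0.
by rewrite r0; apply: DeriveDef; [exact: cvgP H|exact: cvg_lim H].
Unshelve. all: by end_near. Qed.

(** The derivative is carried as a witness, so that explicit formulas can be supplied at each
    order. *)
Fixpoint Ck1 (k : nat) (f : R -> R) : Prop :=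
  continuous f /\
  if k is k'.+1 then exists2 f' : R -> R, (forall x : R, is_derive x 1 f (f' x)) & Ck1 k' f'
  else True.

(** The polynomial factor makes the family closed under differentiation: a derivative changes [p]
    and lowers [k] by one. *)
Definition poly_bump (p : {poly R}) k (x : R) := p.[x] * relu_exp k (1 - x ^+ 2).

Lemma continuous_bump p k : continuous (poly_bump p k).
Proof.
move=> x; apply: continuousM; first exact: continuous_horner.
apply: (@continuous_comp _ _ _ (fun y : R => 1 - y ^+ 2)); last exact: continuous_relu_exp.
by apply: continuousB; [exact: cvg_cst|exact: exprn_continuous].
Qed.

Lemma is_derive_bump p k (x : R) : is_derive x 1 (poly_bump p k.+2)
  (poly_bump (p^`() * (1 - 'X^2) - p * ((2 * k.+2%:R) *: 'X)) k.+1 x).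
Proof.
have dp : is_derive x 1 (horner p) p^`().[x].
  by apply: DeriveDef; [exact: derivable_horner|rewrite derivE derive1E].
have dq : is_derive x 1 (fun y : R => 1 - y ^+ 2) (- (2 * x)).
  have := is_deriveB (is_derive_cst (1 : R) x (1 : R)) (is_derive_exprn 2 x).
  by rewrite sub0r expr1.
have := is_deriveM dp (@is_derive1_comp R _ (fun y => 1 - y ^+ 2) _ _ _
  (is_derive_relu_exp k (1 - x ^+ 2)) dq).
set d := (X in is_derive _ _ _ X); set q := (X in poly_bump X k.+1).
suff <- : d = poly_bump q k.+1 x by [].
rewrite /d /q /poly_bump /GRing.scale/= relu_expS.
rewrite !(hornerD, hornerM, hornerN, hornerZ, hornerX, hornerXn, hornerC).
by ring.
Qed.

Lemma Ck1W {k f} : Ck1 k.+1 f -> Ck1 k f.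
Proof.
elim: k f => [|k IHk] f; first by case.
by move=> [cf [f' df Cf']]; split=> //; exists f' => //; exact: IHk.
Qed.

Lemma Ck1_bump p k : Ck1 k (poly_bump p k.+1).
Proof.
elim: k p => [|k IHk] p; split=> //; try exact: continuous_bump.
by eexists; [move=> x; exact: is_derive_bump|exact: IHk].
Qed.

(** One function per coordinate, rather than a single common one, because a partial derivative
    alters just one factor. *)
Definition tensor n (F : 'I_n -> R -> R) (x : 'rV[R]_n) := \prod_(i < n) F i (x ord0 i).

Lemma continuous_tensor n (F : 'I_n -> R -> R) :
  (forall i, continuous (F i)) -> continuous (tensor n F).
Proof.
move=> cF; rewrite /tensor; elim: (index_enum _) => [|i r IHr].
  by under eq_fun do rewrite big_nil; exact: cst_continuous.
under eq_fun do rewrite big_cons.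
move=> x; apply: continuousM; last exact: IHr.
by apply: continuous_comp; [exact: continuous_coord|exact: cF].
Qed.

(** Along a line in direction [j] all factors but the [j]-th are constant; [c] is their product. *)
Lemma is_derive_tensor n (F : 'I_n -> R -> R) (j : 'I_n) f' :
  (forall x : R, is_derive x 1 (F j) (f' x)) ->
  forall x, is_derive x (delta_mx 0 j) (tensor n F)
    (tensor n (fun i => if i == j then f' else F i) x).
Proof.
move=> dF x; set c := \prod_(i < n | i != j) F i (x ord0 i).
have -> : tensor n (fun i => if i == j then f' else F i) x = c * f' (x ord0 j).
  rewrite /tensor (bigD1 j)//= eqxx mulrC; congr (_ * _).
  by apply: eq_bigr => i /negbTE ->.
have E (h : R) : tensor n F (h *: delta_mx 0 j + x) =
    (c \*: F j) (h *: 1 + x ord0 j).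
  rewrite /tensor (bigD1 j)//= mulrC; congr (_ * F j _).
    apply: eq_bigr => i /negbTE ij.
    by rewrite !mxE ij andbF mulr0 add0r.
  by rewrite !mxE !eqxx.
have dE : is_derive (x ord0 j) 1 (c \*: F j) (c *: f' (x ord0 j)).
  exact: is_deriveZ.
apply: DeriveDef.
  by apply: derivable_eq_line (@ex_derive _ _ _ _ _ _ _ dE) => h; rewrite -E.
by rewrite (derive_eq_line E) (@derive_val _ _ _ _ _ _ _ dE).
Qed.

Lemma Ck_tensor n k (F : 'I_n -> R -> R) : (forall i, Ck1 k (F i)) -> Ck k (tensor n F).
Proof.
elim: k F => [|k IHk] F CF; split=> //;
  try by apply: continuous_tensor => i; case: (CF i).
move=> j; have [_ [f' df Cf']] := CF j.
split; first by move=> x; exact: (@ex_derive _ _ _ _ _ _ _ (is_derive_tensor n F j f' df x)).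
rewrite (_ : partial j _ = tensor n (fun i => if i == j then f' else F i)).
  (* The new tensor has the derivative as its [j]-th factor; the other factors only need to give up
     one order of regularity. *)
  apply: IHk => i; case: ifP => // _.
  exact/Ck1W/CF.
by apply/funext => x; exact: (@derive_val _ _ _ _ _ _ _ (is_derive_tensor n F j f' df x)).
Qed.

End poly_bump.

(** * Scaling of derivatives, and a nonnegative bump *)

Section dilation.
Context {R : realType} {n : nat}.
Implicit Types (f : 'rV[R]_n -> R) (c r : R).

(** The prefactor [c] absorbs the power of [r] produced by each derivative, so derivatives of
    dilations are again dilations. *)
Definition dilation c r f (x : 'rV[R]_n) := c * f (r *: x).

(** Restricted to the line through [r *: x] in the given direction, the claim becomes the
    one-variable chain rule for h |-> r h, for which directional derivability of [f] is enough. *)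
Lemma is_derive_dilation {c r f x i} :
  derivable f (r *: x) (delta_mx 0 i) ->
  is_derive x (delta_mx 0 i) (dilation c r f) (dilation (c * r) r (partial i f) x).
Proof.
move=> df; set d := delta_mx 0 i in df *.
pose G (s : R) := f (s *: d + r *: x).
have GE (h : R) : f (h *: d + r *: x) = G (h *: 1 + 0).
  by rewrite /G addr0 [_ *: 1]mulr1.
have dG : is_derive (r * 0) 1 G (partial i f (r *: x)).
  rewrite mulr0; apply: DeriveDef; first exact: derivable_eq_line GE df.
  by rewrite -(derive_eq_line GE).
have dr : is_derive (0 : R) 1 (fun h : R => r * h) r.
  have := is_deriveZ r (is_derive_id (0 : R) (1 : R)).
  by rewrite /GRing.scale/= mulr1.
have dH := is_deriveZ c (@is_derive1_comp R _ (fun h => r * h) _ _ _ dG dr).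
have HE (h : R) : dilation c r f (h *: d + x) =
    (c \*: (G \o (fun h => r * h))) (h *: 1 + 0).
  by rewrite /dilation /G/= addr0 [_ *: 1]mulr1 scalerDr scalerA.
apply: DeriveDef.
  exact: derivable_eq_line (fun h => esym (HE h)) (@ex_derive _ _ _ _ _ _ _ dH).
rewrite (derive_eq_line HE) (@derive_val _ _ _ _ _ _ _ dH).
by rewrite /dilation /GRing.scale/= mulrA mulrAC.
Qed.

Lemma partial_dilation {c r f} i : (forall x, derivable f x (delta_mx 0 i)) ->
  partial i (dilation c r f) = dilation (c * r) r (partial i f).
Proof.
move=> df; apply/funext => x.
exact: (@derive_val _ _ _ _ _ _ _ (is_derive_dilation (df _))).
Qed.

Lemma continuous_dilation {c r f} : continuous f -> continuous (dilation c r f).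
Proof.
move=> cf x; apply: continuousM; first exact: cst_continuous.
by apply: continuous_comp; [exact: scaler_continuous|exact: cf].
Qed.

Lemma Ck_dilation {k c r f} : Ck k f -> Ck k (dilation c r f).
Proof.
elim: k c f => [|k IHk] c f [cf fk]; split=> //; try exact: continuous_dilation.
move=> i; have [df Cf] := fk i; split; last by rewrite partial_dilation//; exact: IHk.
by move=> x; exact: (@ex_derive _ _ _ _ _ _ _ (is_derive_dilation (df _))).
Qed.

Lemma laplacian_dilation {c r f} : Ck 2 f ->
  laplacian (dilation c r f) = dilation (c * r ^+ 2) r (laplacian f).
Proof.
move=> Cf; apply/funext => x; rewrite /laplacian /dilation mulr_sumr.
apply: eq_bigr => i _.
rewrite (partial_dilation i (Ck_derivable i Cf)).
rewrite (partial_dilation i (Ck_derivable i (Ck_partial i Cf))).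
by rewrite /dilation expr2 !mulrA.
Qed.

Lemma iter_opp_laplacian_dilation {m c r f} : Ck m.*2 f ->
  iter_opp_laplacian m (dilation c r f) =
  dilation (c * r ^+ m.*2) r (iter_opp_laplacian m f).
Proof.
elim: m => [|m IHm] Cf; first by rewrite expr0 mulr1.
apply/funext => x; rewrite /= IHm; last by apply: Ck_leq Cf; rewrite doubleS !leqW.
rewrite laplacian_dilation; last by apply: Ck_iter_opp_laplacian; rewrite addn2 -doubleS.
by rewrite /dilation doubleS -[in RHS]addn2 exprD mulrN !mulrA.
Qed.

Lemma supported_dilation {M c r f} : 0 < r ->
  supported n M f -> supported n (r^-1 * M) (dilation c r f).
Proof.
move=> r0 sf x xM; rewrite /dilation sf ?mulr0// => rxM; apply: xM => i.
have := rxM i; rewrite mxE normrM gtr0_norm//.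
by rewrite mulrC -ler_pdivlMr// mulrC.
Qed.

Lemma exists_test_function k : exists f, [/\ Ck k f, supported n 1 f,
  (forall x, 0 <= f x) & exists2 c, 0 < c & forall x, cube n 2^-1 x -> c <= f x].
Proof.
have b0 (t : R) : 0 <= poly_bump 1 k.+1 t.
  by rewrite /poly_bump hornerC mul1r exprn_ge0// le_max lexx.
exists (tensor n (fun=> poly_bump 1 k.+1)); split.
- by apply: Ck_tensor => _; exact: Ck1_bump.
- move=> x /existsNP[i /negP]; rewrite -ltNge => xi.
  rewrite /tensor (bigD1 i)//= /poly_bump relu_exp_le0 ?mulr0 ?mul0r//.
  by rewrite subr_le0 -real_normK ?num_real// expr_ge1// ltW.
- by move=> x; exact: prodr_ge0.
(* For |t| <= 1/2 one has 1 - t^2 >= 3/4, which bounds each of the [n] factors from below. *)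
exists (((3 / 4) ^+ k.+1) ^+ n); first by rewrite !exprn_gt0// divr_gt0.
move=> x xM; rewrite -[X in _ ^+ X]card_ord -prodr_const.
apply: ler_prod => i _; rewrite exprn_ge0/= ?divr_ge0//.
have x2 : x ord0 i ^+ 2 <= 1 / 4.
  rewrite -real_normK ?num_real//; have := xM i; have := normr_ge0 (x ord0 i).
  nra.
rewrite /poly_bump hornerC mul1r relu_exp_ge0; last by lra.
by rewrite lerXn2r// ?nnegrE; lra.
Qed.

End dilation.

(** * The Liouville-type estimate for square-integrable functions *)

Section liouville.
Context {R : realType} {n : nat}.

Lemma integrable_cst_cube (k M : R) : 0 <= M ->
  (lebesgue_rV R n).-integrable setT (EFin \o (cst k \_ (cube n M))).
Proof.
move=> M0; have fin : (lebesgue_rV R n (cube n M) < +oo)%E.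
  by rewrite lebesgue_cube// ltry.
have ic : (lebesgue_rV R n).-integrable (cube n M) (EFin \o cst k).
  apply: measurable_bounded_integrable; first exact: measurable_cube.
  - exact: fin.
  - exact: measurable_cst.
  - by exists `|k|; split=> [|y ky x _]; [exact: normr_real|exact: ltW].
rewrite -restrict_EFin.
exact: (iffLR (integrable_mkcond _ (measurable_cube n M)) ic).
Qed.

Lemma Rintegral_cst_cube (k M : R) : 0 <= M ->
  \int[lebesgue_rV R n]_x (cst k \_ (cube n M)) x = k * (2 * M) ^+ n.
Proof.
move=> M0; rewrite -Rintegral_mkcond Rintegral_cst; last exact: measurable_cube.
by congr (_ * _); exact: (congr1 fine (lebesgue_cube n M M0)).
Qed.

(** The right-hand side minus the left-hand side is (a x - y)^2 / (2a). *)
Lemma young_le (a x y : R) : 0 < a -> x * y <= a / 2 * x ^+ 2 + y ^+ 2 / (2 * a).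
Proof.
move=> a0; rewrite -subr_ge0.
have -> : a / 2 * x ^+ 2 + y ^+ 2 / (2 * a) - x * y = (a * x - y) ^+ 2 / (2 * a).
  by field; rewrite gt_eqF.
by rewrite divr_ge0 ?sqr_ge0// mulr_ge0// ltW.
Qed.

(** The condition on [n] and [m] says that r^(4m - n) tends to 0 with r: r^(4m) comes from squaring
    [m] rescaled Laplacians, r^(-n) from the volume of the rescaled support. *)
Lemma iter_opp_laplacian_L2_le0 {m} {v : 'rV[R]_n -> R} : (n < 4 * m)%N ->
  Ck m.*2 v -> (lebesgue_rV R n).-integrable setT (fun x => (v x ^+ 2)%:E) ->
  (forall x, 0 <= iter_opp_laplacian m v x) -> iter_opp_laplacian m v 0 <= 0.
Proof.
move=> nm Cv iv2; set f := iter_opp_laplacian m v => f_ge0.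
rewrite leNgt; apply/negP => f0.
have Cf : Ck 0 f by apply: Ck_iter_opp_laplacian; rewrite addn0.
(* The bound [e <= 2^-1] ensures that for [x] in [cube n e] and 0 < r <= 1 the point [r *: x] stays
   in the cube where the bump is at least [c]. *)
have [e /andP[e0 e2] fe] : exists2 e : R, 0 < e <= 2^-1 &
    forall x, cube n e x -> f 0 / 2 <= f x.
  have f02 : f 0 / 2 < f 0 by lra.
  have /nbhs_rV_box[e e0 fe] := Ck_continuous Cf 0 _ (lt_nbhsr f02).
  (* Halving [e] turns the closed inequalities of the cube into the strict ones of the
     neighbourhood. *)
  exists (Num.min (e / 2) 2^-1); first by rewrite lt_min divr_gt0// invr_gt0 ltr0n ge_min lexx orbT.
  move=> x xe; apply: ltW; apply: fe => i; rewrite mxE subr0.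
  by apply: le_lt_trans (xe i) _; rewrite gt_min; apply/orP; left; lra.
have [phi [Cphi sphi phi0 [c c0 phic]]] := @exists_test_function R n m.*2.
set psi := iter_opp_laplacian m phi.
have Cpsi : Ck 0 psi by apply: Ck_iter_opp_laplacian; rewrite addn0.
have spsi : supported n 1 psi by exact: supported_iter_opp_laplacian.
have [C C0 psiC] := continuous_supported_bounded (Ck_continuous Cpsi) spsi.
(* Lower bound for the integral of [f] against the dilated bump, uniform in [r]: on [cube n e], of
   volume [(2 * e) ^+ n], the factors are at least [f 0 / 2] and [c]. *)
pose d := f 0 / 2 * c * (2 * e) ^+ n.
have d0 : 0 < d by rewrite !mulr_gt0 ?exprn_gt0 ?mulr_gt0// divr_gt0.
pose A := \int[lebesgue_rV R n]_x v x ^+ 2.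
have A0 : 0 <= A by apply: Rintegral_ge0 => x _; exact: sqr_ge0.
pose K := C ^+ 2 * 2 ^+ n.
have K0 : 0 <= K by rewrite mulr_ge0// exprn_ge0.
have key (a r : R) : 0 < a -> 0 < r <= 1 -> d <= a / 2 * A + K / (2 * a) * r.
  move=> a0 /andP[r0 r1].
  pose phir := dilation 1 r phi.
  have Cphir : Ck m.*2 phir by exact: Ck_dilation.
  have sphir : supported n (r^-1 * 1) phir by exact: supported_dilation.
  have ifphi := Ck_supported_integrable Cf (Ck_leq (leq0n _) Cphir) sphir.
  have lower : d <= \int[lebesgue_rV R n]_x (f x * phir x).
    rewrite /d -(Rintegral_cst_cube _ e (ltW e0)).
    apply: le_Rintegral => // [|x _]; first exact/integrable_cst_cube/ltW.
    rewrite patchE; case: ifPn => [|_]; last first.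
      by rewrite mulr_ge0// /phir /dilation mul1r.
    rewrite inE => xe; rewrite /phir /dilation mul1r.
    apply: ler_pM; [by rewrite divr_ge0// ltW|exact: ltW|exact: fe|apply: phic => i].
    rewrite mxE normrM gtr0_norm//; apply: le_trans e2; apply: le_trans (xe i).
    by rewrite ler_piMl.
  apply: le_trans lower _.
  rewrite (integral_iter_opp_laplacian Cv Cphir sphir).
  have LE := @iter_opp_laplacian_dilation R n m 1 r phi Cphi.
  have CLr : Ck 0 (iter_opp_laplacian m phir).
    by apply: Ck_iter_opp_laplacian; rewrite addn0.
  have sLr : supported n (r^-1 * 1) (iter_opp_laplacian m phir).
    exact: supported_iter_opp_laplacian.
  (* Bound for the second term of Young's inequality. It is charged only on the cube of half-side
     [r^-1], outside which the dilated test function vanishes. *)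
  pose k := (r ^+ m.*2 * C) ^+ 2 / (2 * a).
  have rV0 : 0 <= r^-1 by rewrite invr_ge0 ltW.
  have iav : (lebesgue_rV R n).-integrable setT (EFin \o (fun x => a / 2 * v x ^+ 2)).
    exact: (integrableZl measurableT (a / 2) iv2).
  have ick := integrable_cst_cube k (r^-1) rV0.
  have : \int[lebesgue_rV R n]_x (v x * iter_opp_laplacian m phir x) <=
      \int[lebesgue_rV R n]_x (a / 2 * v x ^+ 2 + (cst k \_ (cube n r^-1)) x).
    apply: le_Rintegral => //.
    - exact: Ck_supported_integrable (Ck_leq (leq0n _) Cv) CLr sLr.
    - exact: (integrableD measurableT iav ick).
    move=> x _; rewrite patchE; case: ifPn => [_|/negP]; last first.
      rewrite inE => xr; rewrite sLr ?mulr1// mulr0 addr0.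
      by rewrite mulr_ge0 ?sqr_ge0// divr_ge0// ltW.
    apply: le_trans (young_le a _ _ a0) _; rewrite lerD2l /k ler_pM2r ?invr_gt0 ?mulr_gt0//.
    rewrite LE /dilation mul1r !exprMn ler_pM2l ?exprn_gt0//.
    by rewrite -real_normK ?num_real// lerXn2r ?nnegrE.
  move=> /le_trans; apply.
  rewrite RintegralD// RintegralZl// Rintegral_cst_cube// lerD2l.
  rewrite /k /K !exprMn.
  have -> : (r ^+ m.*2) ^+ 2 * C ^+ 2 / (2 * a) * (2 ^+ n * r^-1 ^+ n) =
      C ^+ 2 * 2 ^+ n / (2 * a) * (r ^+ (4 * m) * r^-1 ^+ n).
    by rewrite -exprM -muln2 -mulnA [(m * _)%N]mulnC; ring.
  rewrite ler_wpM2l//; first by rewrite divr_ge0// mulr_ge0// ltW.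
  (* After cancellation r^(4m - n) remains; it is at most [r] because the exponent is at least 1 and
     [r <= 1]. *)
  rewrite -(subnKC (ltnW nm)) exprD mulrAC -exprMn divff ?gt_eqF// expr1n mul1r.
  by rewrite -[leRHS]expr1 ler_wiXn2l// ?ltW// subn_gt0.
(* [a] brings the first term of [key] strictly below [d / 2], then [r] brings the second to at most
   [d / 2]. Adding 1 to [A] and [K] keeps the denominators positive. *)
pose a := d / (A + 1).
have a0 : 0 < a by rewrite divr_gt0// ltr_wpDl.
pose r := Num.min 1 (a * d / (K + 1)).
have K1 : 0 < K + 1 by rewrite ltr_wpDl.
have r01 : 0 < r <= 1.
  rewrite lt_min ltr01 ge_min lexx/= andbT.
  by apply: divr_gt0 => //; exact: mulr_gt0.
have := key a r a0 r01; apply/negP; rewrite -ltNge.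
have h1 : a / 2 * A < d / 2.
  have -> : d = a * (A + 1) by rewrite /a mulfVK// gt_eqF// ltr_wpDl.
  by rewrite mulrAC ltr_pM2r ?invr_gt0// ltr_pM2l//; lra.
have h2 : K / (2 * a) * r <= d / 2.
  apply: (@le_trans _ _ (K / (2 * a) * (a * d / (K + 1)))).
    by rewrite ler_wpM2l ?ge_min ?lexx ?orbT// divr_ge0// mulr_ge0// ltW.
  have -> : K / (2 * a) * (a * d / (K + 1)) = d / 2 * (K / (K + 1)).
    by field; rewrite !gt_eqF.
  apply: ler_piMr; first by rewrite divr_ge0// ltW.
  by rewrite ler_pdivrMr// mul1r; lra.
lra.
Qed.

End liouville.

(** * Non-existence of the positive solution *)

Theorem theorem1p3 (R : realType) (N : nat) (N_ge2 : (2 <= N)%N) :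
  ~ exists u : 'rV[R]_(2 * N - 1)%N -> R,
      (forall x, 0 < u x) /\
      Ck (2 * N)%N u /\
      (forall x, iter_opp_laplacian N u x = u x ^- (4 * N - 1)%N) /\
      (\int[lebesgue_rV R (2 * N - 1)%N]_x (u x ^- (4 * N - 2)%N)%:E < +oo)%E /\
      (forall x, 1 <= u x) /\ u 0 = 1 /\
      (forall i : nat, (1 <= i <= N - 1)%N ->
        iter_opp_laplacian i u \in Lfun (lebesgue_rV R (2 * N - 1)%N) 2%:E).
Proof.
case: N N_ge2 => [//|m] m_gt0 [u [u_gt0 [Cu [eqn [_ [_ [_ L2]]]]]]].
(* The equation is regrouped as m = N - 1 Laplacians applied to -Delta u, the function that
   condition (3) with i = 1 places in L^2. *)
have eqm x : iter_opp_laplacian m (iter_opp_laplacian 1 u) x = u x ^- (4 * m.+1 - 1).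
  by rewrite -eqn /iter_opp_laplacian -iterSr.
have f_gt0 x : 0 < iter_opp_laplacian m (iter_opp_laplacian 1 u) x.
  by rewrite eqm invr_gt0 exprn_gt0.
have : iter_opp_laplacian m (iter_opp_laplacian 1 u) 0 <= 0.
  apply: iter_opp_laplacian_L2_le0.
  (* Here n = 2m + 1, and 2m + 1 < 4m holds exactly when m >= 1, that is, N >= 2. *)
  - lia.
  - by apply: Ck_iter_opp_laplacian; rewrite -doubleD add1n -mul2n.
  - have := L2 1%N; rewrite subn1 /= => /(_ m_gt0) /Lfun_integrable.
    rewrite ler1n => /(_ isT); apply: eq_integrable => // x _.
    by rewrite powR_mulrn// real_normK ?num_real.
  - by move=> x; exact: ltW.
by rewrite leNgt f_gt0.
Qed.
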